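(* Let $(L,d)$ be a complete metric space and let $(X,\|\cdot\|_X)$ be a Banach space included in $C_b(L)$ such that (a) $\|\cdot\|_X\ge\alpha\|\cdot\|_\infty$ on $X$, for some $\alpha>0$; (b) for every $\varepsilon>0$ there exists $\varpi_X(\varepsilon)>0$ such that for every $x\in L$ there exists a function $b_{x,\varepsilon}\in B_X$ such that $$b_{x,\varepsilon}(x)-\varpi_X(\varepsilon)\ge\sup_{y\in L:\ d(y,x)\ge\varepsilon}b_{x,\varepsilon}(y).$$ Let $f:L\to\mathbb{R}\cup\{+\infty\}$ be a proper bounded from below lower semicontinuous function. Then there exists a $\sigma$-porous subset $F$ of $X$ such that for every $h\in X\setminus F$, $f+h$ has a strong minimum on $L$.
   Context: $C_b(L)$ is the space of real-valued bounded continuous functions on $L$ with the sup-norm $\|\cdot\|_\infty$; $B_X$ is the closed unit ball of $(X,\|\cdot\|_X)$. A function is proper if it is not identically $+\infty$. Strong minimum: a function $g$ has a strong minimum on a metric space $(L,d)$ at $p\in L$ if $g$ attains its minimum at $p$ and every sequence $(p_n)\subset L$ with $g(p_n)\to g(p)=\inf_L g$ satisfies $d(p_n,p)\to0$. $\sigma$-porosity: a subset $A$ of a metric space $M$ is porous in $M$ if there exist $\lambda_0\in(0,1]$ and $r_0>0$ such that for any $x\in M$ and $r\in(0,r_0]$ there exists $y\in M$ such that $\mathring{B}(y;\lambda_0 r)\subset\mathring{B}(x;r)\cap(M\setminus A)$, where $\mathring{B}(\cdot\,;\cdot)$ denotes open balls of $M$. $A$ is $\sigma$-porous if it is a countable union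 of porous sets in $M$. Here $M=(X,\|\cdot\|_X)$. *)

(* Defs.v *)
From mathcomp Require Import all_boot all_order all_algebra.
From mathcomp Require Import all_classical all_reals all_analysis.

Set Implicit Arguments.
Unset Strict Implicit.
Unset Printing Implicit Defensive.

Import Order.TTheory GRing.Theory Num.Theory.
Import numFieldNormedType.Exports.

Local Open Scope classical_set_scope.
Local Open Scope ring_scope.

(* The library's [completeType] is pointed and has no join with [metricType],
   so completeness of a metric space is expressed by Cauchy sequences. *)
Definition metric_complete (R : realType) (L : metricType R) : Prop :=
  forall u : nat -> L, cauchy (u n @[n --> \oo]) ->
    exists l : L, u n @[n --> \oo] --> l.

Definition Cb (R : realType) (L : metricType R) : set (L -> R) :=
  [set u : L -> R | continuous u /\ [bounded u x | x in [set: L]]].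

Definition sup_norm (R : realType) (L : Type) (u : L -> R) : R :=
  sup (range (fun x => `|u x|)).

Definition strong_minimum (R : realType) (L : metricType R)
    (g : L -> \bar R) (p : L) : Prop :=
  (forall q, (g p <= g q)%E) /\
  forall u : nat -> L, g (u n) @[n --> \oo] --> g p ->
    mdist (u n) p @[n --> \oo] --> (0 : R).

(* In a normed module, [ball x r] is the open ball [set y | `|x - y| < r]. *)
Definition porous (R : realType) (M : normedModType R) (A : set M) : Prop :=
  exists lambda0 r0 : R, [/\ 0 < lambda0 <= 1, 0 < r0 &
    forall (x : M) (r : R), 0 < r <= r0 ->
      exists y : M, ball y (lambda0 * r) `<=` ball x r `&` ~` A].

(* The empty set is porous, so families indexed by [nat] cover finite unions. *)
Definition sigma_porous (R : realType) (M : normedModType R) (A : set M) : Prop :=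
  exists P : nat -> set M, (forall n, porous (P n)) /\ A = \bigcup_n P n.

(* Main.v *)
Require Import Defs.
From mathcomp Require Import all_boot all_order all_algebra.
From mathcomp Require Import all_classical all_reals all_analysis.
From mathcomp Require Import lra.

Import Order.TTheory GRing.Theory Num.Theory.
Import numFieldNormedType.Exports.

Local Open Scope classical_set_scope.
Local Open Scope ring_scope.

(** The idea is to replace strong minimality, a statement about limits, by a
    countable family of quantitative conditions. Say that [g] localizes its
    minimum at scale [eps] when some point [x] with [g x] finite satisfies
    [g >= g x + delta] outside the ball of radius [eps] around [x], for some
    [delta > 0] ([localizes_minimum]).

    Localization at all the scales [1 / (n + 1)], with centres [x_ n], gives a
    strong minimum ([localized_strong_minimum]): of two centres, the one with
    the smaller value of [g] lies in the ball around the other one, so the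
    centres form a Cauchy sequence, and lower semicontinuity makes its limit
    the strong minimum.

    At a fixed scale, the set of those [h] for which [f + h] fails to localize
    its minimum is porous ([porous_not_localizes]): choose an almost minimizer
    [x] of [f + h] and subtract from [h] a small multiple of the bump at [x].
    The bump digs a well at [x] whose depth is proportional to the size of the
    perturbation, so that localization persists on a ball of proportional
    radius around the perturbed function; here the domination of the sup-norm
    by the norm of [X] is what makes perturbations in [X] uniformly small.
    The exceptional set is the union of these porous sets over [n]. *)

Definition localizes_minimum {R : realType} {L : metricType R}
    (g : L -> \bar R) (eps : R) : Prop :=
  exists x : L, exists2 delta : R, 0 < delta & g x \is a fin_num /\
    forall y : L, (g y < g x + delta%:E)%E -> mdist y x < eps.

(** Everything follows from one remark ([x_loc]): a point at which [g] does not
    exceed [g (x_ n)] is within [1 / (n + 1)] of [x_ n]. In particular a point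
    [q] with [g q < g p], where [p] is the limit of the [x_ n], would by lower
    semicontinuity have [g q < g (x_ n)] for large [n], and so be the limit of
    the [x_ n] as well. *)
Lemma localized_strong_minimum (R : realType) (L : metricType R)
    (g : L -> \bar R) :
  metric_complete L -> lower_semicontinuous g ->
  (forall n : nat, localizes_minimum g n.+1%:R^-1) ->
  exists p : L, strong_minimum g p.
Proof.
move=> Lc gl loc.
have [x_ /= Hx] := choice loc.
have x_loc n y : (g y <= g (x_ n))%E -> mdist y (x_ n) < n.+1%:R^-1.
  move=> gy; have [d d0 [gx]] := Hx n; apply.
  by rewrite (le_lt_trans gy)// lteDl// lte_fin.
have small (e : R) : 0 < e -> \forall n \near \oo, n.+1%:R^-1 < e.
  by move=> e0; exact: (near_infty_natSinv_lt (PosNum e0)).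
have x_cauchy : cauchy (x_ n @[n --> \oo]).
  apply/cauchy_ballP => e e0; near_simpl => /=.
  suff : \forall n & m \near \oo, ball (x_ n) e (x_ m) by [].
  near=> n m.
  have ne : n.+1%:R^-1 < e by near: n; exact: small.
  have me : m.+1%:R^-1 < e by near: m; exact: small.
  rewrite ballEmdist/=.
  have [le_nm|/ltW le_mn] := leP (g (x_ n)) (g (x_ m)).
    exact: lt_trans (x_loc _ _ le_nm) me.
  by rewrite metric_sym; exact: lt_trans (x_loc _ _ le_mn) ne.
have [p xp] := Lc _ x_cauchy.
have xpd (e : R) : 0 < e -> \forall n \near \oo, mdist p (x_ n) < e.
  by move=> e0; exact: (metricType_numDomainType.cvgr_dist_lt xp e0).
have p_min q : (g p <= g q)%E.
  rewrite leNgt; apply/negP => qp.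
  (* lower semicontinuity is tested against real levels only *)
  have [t qt tp] : exists2 t : R, (g q <= t%:E)%E & (t%:E < g p)%E.
    case: (g q) qp => [r| |]; [by exists r|by rewrite ltNge leey|].
    case: (g p) => [s| |] // _; last by exists 0; rewrite ?leNye ?ltry.
    by exists (s - 1); rewrite ?leNye// lte_fin; lra.
  have [V Vp gV] := gl p t tp.
  have Vx : \forall n \near \oo, V (x_ n) by exact: xp Vp.
  suff pq : p = q by move: qp; rewrite pq ltxx.
  apply: mdist_positivity; apply/eqP; rewrite eq_le mdist_ge0 andbT.
  apply/ler_addgt0Pl => e e0; rewrite addr0.
  near \oo => n.
  have qx : mdist q (x_ n) < n.+1%:R^-1.
    apply: x_loc; apply: (le_trans qt); apply/ltW/gV.
    by near: n.
  have : n.+1%:R^-1 < e / 2 by near: n; apply: small; rewrite divr_gt0.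
  have : mdist p (x_ n) < e / 2 by near: n; apply: xpd; rewrite divr_gt0.
  have := metric_triangle p (x_ n) q.
  move: qx; rewrite (metric_sym q); move: (n.+1%:R^-1) => a; lra.
exists p; split => // u gu.
apply/cvgrPdist_lt => e e0.
have [n ne] : exists n : nat, n.+1%:R^-1 < e / 2.
  have /small : 0 < e / 2 by rewrite divr_gt0.
  by move=> H; near \oo => n; exists n; near: n.
have px : mdist p (x_ n) < n.+1%:R^-1 by exact: x_loc.
have [d d0 [gx gd]] := Hx n.
(* Since [g p < g (x_ n) + d], the values [g (u k)] eventually stay below this
   level, which traps [u k] in the same small ball as [p]. *)
have gpx : (g p < g (x_ n) + d%:E)%E.
  by rewrite (le_lt_trans (p_min (x_ n)))// lteDl// lte_fin.
have : \forall k \near \oo, (g (u k) < g (x_ n) + d%:E)%E.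
  apply: (gu [set z | (z < g (x_ n) + d%:E)%E]).
  by apply: open_nbhs_nbhs; split => //; exact: open_ereal_lt_ereal.
apply: filterS => k /gd ux.
rewrite sub0r normrN ger0_norm ?mdist_ge0//.
have := metric_triangle (u k) (x_ n) p.
by move: ux px ne; rewrite (metric_sym (x_ n)); move: (n.+1%:R^-1) => a; lra.
Unshelve. all: by end_near. Qed.

Lemma lower_semicontinuousDr (R : realType) (T : topologicalType)
    (f : T -> \bar R) (u : T -> R) :
  lower_semicontinuous f -> continuous u ->
  lower_semicontinuous (fun x => (f x + (u x)%:E)%E).
Proof.
move=> fl uc x a afu.
(* A real [t] splits the margin between [f] and [u]: near [x], [f > t] and
   [u > a - t]. *)
have [t at_ tf] : exists2 t : R, a - u x < t & (t%:E < f x)%E.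
  case: (f x) afu => [r| |] //.
    rewrite -EFinD lte_fin => ar.
    by exists ((a - u x + r) / 2); rewrite ?lte_fin; lra.
  by exists (a - u x + 1); rewrite ?ltry//; lra.
have [V Vx fV] := fl x t tf.
exists (V `&` [set y | a - t < u y]).
  apply: filterI => //.
  by apply: (cvgr_gt (u x)); [exact: uc|lra].
move=> y [/fV ty uy].
have -> : a%:E = (t%:E + (a - t)%:E)%E by rewrite -EFinD; congr EFin; lra.
by apply: lteD; rewrite ?lte_fin.
Qed.

Lemma exists_almost_minimizer (R : realType) (T : Type) (g : T -> \bar R)
    (m e : R) :
  (forall x, (m%:E <= g x)%E) -> (exists x, g x <> +oo%E) -> 0 < e ->
  exists2 x, g x \is a fin_num & forall y, (g x <= g y + e%:E)%E.
Proof.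
move=> gm [x0 gx0] e0.
have mI : (m%:E <= ereal_inf (range g))%E by apply/le_ereal_inf_tmp => _ [y _ <-].
have Ifin : ereal_inf (range g) \is a fin_num.
  rewrite fin_numE gt_eqF ?(lt_le_trans _ mI) ?ltNyr//=.
  rewrite lt_eqF//; apply: (@le_lt_trans _ _ (g x0)); last first.
    by rewrite ltey; apply/eqP.
  by apply: ereal_inf_lbound; exists x0.
have [_ [x _ <-] xI] := lb_ereal_inf_adherent e0 Ifin.
exists x.
  rewrite fin_numE gt_eqF ?(lt_le_trans _ (gm x)) ?ltNyr//=.
  by rewrite lt_eqF// (lt_trans xI)// -(fineK Ifin) -EFinD ltry.
move=> y; apply: (le_trans (ltW xI)); apply: leeD => //.
by apply: ereal_inf_lbound; exists y.
Qed.

Lemma le_sup_norm (R : realType) (L : metricType R) (u : L -> R) (x : L) :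
  Cb u -> `|u x| <= sup_norm u.
Proof.
move=> [_ [M [_ uM]]]; apply: ub_le_sup; last by exists x.
exists (M + 1) => _ [y _ <-]; apply: (uM (M + 1)) => //; lra.
Qed.

(** Given [h] and [r], the centre of the hole is [h' = h - (r / 2) *: b], where
    [b] is the bump at a point [x] minimizing [f + h] up to [r * varpi / 4].
    Off the [eps]-ball around [x], the bump makes [f + h'] exceed its value
    at [x] by at least [r * varpi / 2 - r * varpi / 4]. A further perturbation
    of sup-norm below [r * varpi / 16] costs at most [r * varpi / 8] of this gap
    and leaves [delta = r * varpi / 8]. *)
Lemma porous_not_localizes (R : realType) (L : metricType R)
    (X : normedModType R) (ev : {linear X -> (L -> R^o)}) (f : L -> \bar R)
    (alpha varpi eps : R) :
  (forall h : X, Cb (ev h)) ->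
  0 < alpha -> (forall h : X, alpha * sup_norm (ev h) <= `|h|) ->
  0 < varpi ->
  (forall x : L, exists2 b : X, `|b| <= 1 &
     forall y, eps <= mdist y x -> ev b y <= ev b x - varpi) ->
  (exists m : R, forall x : L, (m%:E <= f x)%E) ->
  (exists x : L, f x <> +oo%E) ->
  porous [set h : X |
    ~ localizes_minimum (fun x => (f x + (ev h x : R)%:E)%E) eps].
Proof.
move=> evC a0 evN w0 bump [m fm] fp.
have evl (h : X) (x : L) : alpha * `|ev h x| <= `|h|.
  by apply: le_trans (evN h); rewrite ler_pM2l// le_sup_norm.
(* The bound 1/2 keeps the hole inside [ball h r], whose radius is half used by
   the bump; the other one makes an element of norm below [l * r] have sup-norm
   below [r * varpi / 16]. *)
pose l := Num.min (1 / 2) (alpha * varpi / 16).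
have l0 : 0 < l by rewrite lt_min !divr_gt0// ?mulr_gt0.
have l2 : l <= 1 / 2 by rewrite ge_min lexx.
have lw : l <= alpha * varpi / 16 by rewrite ge_min lexx orbT.
exists l, 1; split => //; first by rewrite l0/=; lra.
move=> h r /andP[r0 _].
have [x gx xmin] : exists2 x, f x + (ev h x)%:E \is a fin_num &
    forall y, (f x + (ev h x)%:E <= f y + (ev h y)%:E + (r * varpi / 4)%:E)%E.
  apply: (@exists_almost_minimizer _ _ _ (m - `|h| / alpha)).
  - move=> y; rewrite EFinD; apply: leeD => //; rewrite lee_fin.
    rewrite lerNl ler_pdivlMr// mulrC.
    apply: le_trans (evl h y); rewrite ler_pM2l//.
    by rewrite (le_trans (ler_norm _))// normrN.
  - by have [y fy] := fp; exists y; case: (f y) fy.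
  - by rewrite divr_gt0// mulr_gt0.
have [b b1 bw] := bump x.
exists (h - (r / 2) *: b) => k.
rewrite -ball_normE /= => kb; set h' := h - _ in kb; set d := k - h'.
have dE : `|d| < l * r by rewrite /d distrC.
have kE y : ev k y = ev h y - r / 2 * ev b y + ev d y.
  have -> : k = h - (r / 2) *: b + d by rewrite /d /h' addrC subrK.
  by rewrite linearD linearB linearZ.
split.
  have -> : h - k = (r / 2) *: b - d by rewrite /d opprB addrA subrKC.
  rewrite (le_lt_trans (ler_normB _ _))// normrZ ger0_norm; last by lra.
  have : r / 2 * `|b| <= r / 2 by rewrite ler_piMr//; lra.
  have : l * r <= 1 / 2 * r by rewrite ler_pM2r.
  by lra.
apply => {evC evN bump fp}.
have fx : f x \is a fin_num by case: (f x) gx.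
have ds y : `|ev d y| < r * varpi / 16.
  rewrite -(ltr_pM2l a0); apply: le_lt_trans (evl d y) _.
  apply: (lt_le_trans dE).
  have -> : alpha * (r * varpi / 16) = alpha * varpi / 16 * r by lra.
  by rewrite ler_pM2r.
exists x; exists (r * varpi / 8); first by rewrite divr_gt0// mulr_gt0.
split; first by case: (f x) fx.
move=> y; apply: contraPlt => /bw by_.
apply/negP; rewrite -leNgt.
move: (xmin y) fx {gx}; case: (f x) => [s| |] //.
case: (f y) => [t| |] //=.
  rewrite -!EFinD !lee_fin !kE => xy _.
  have : r / 2 * ev b y <= r / 2 * (ev b x - varpi) by rewrite ler_pM2l//; lra.
  rewrite mulrBr.
  have := ds x; have := ds y; rewrite !ltr_norml => /andP[? ?] /andP[? ?].
  by lra.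
by rewrite -!EFinD /= !leey.
Qed.

Theorem corollary2 (R : realType) (L : metricType R) (X : completeNormedModType R)
    (* the inclusion of X into C_b(L) *)
    (ev : {linear X -> (L -> R^o)})
    (L_complete : metric_complete L)
    (ev_inj : injective ev)
    (ev_Cb : forall h : X, Cb (ev h))
    (norm_ge : exists2 alpha : R, 0 < alpha &
       forall h : X, alpha * sup_norm (ev h) <= `|h|)
    (bumps : forall eps : R, 0 < eps ->
       exists2 varpi : R, 0 < varpi &
         forall x : L, exists2 b : X, `|b| <= 1 &
           (ereal_sup [set (ev b y : R)%:E | y in [set y : L | (eps <= mdist y x)%R]]
              <= (ev b x - varpi : R)%:E)%E)
    (f : L -> \bar R)
    (f_Nninfty : forall x : L, f x <> -oo%E)
    (f_proper : exists x : L, f x <> +oo%E)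
    (f_bounded_below : exists m : R, forall x : L, (m%:E <= f x)%E)
    (f_lsc : lower_semicontinuous f) :
  exists F : set X, sigma_porous F /\
    forall h : X, ~ F h ->
      exists p : L, strong_minimum (fun x : L => (f x + (ev h x : R)%:E)%E) p.
Proof.
pose P n := [set h : X |
  ~ localizes_minimum (fun x => (f x + (ev h x : R)%:E)%E) n.+1%:R^-1].
exists (\bigcup_n P n); split.
  exists P; split => // n.
  have [alpha a0 evN] := norm_ge.
  have [varpi w0 bump] := bumps n.+1%:R^-1 ltac:(by rewrite invr_gt0).
  apply: porous_not_localizes evN w0 _ _ _ => // x.
  have [b b1 sb] := bump x; exists b => // y yx.
  by rewrite -lee_fin (le_trans _ sb)//; apply: ereal_sup_ubound; exists y.
move=> h nF; apply: localized_strong_minimum => //.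
  by apply: lower_semicontinuousDr => //; have [] := ev_Cb h.
by move=> n; apply: contrapT => Pn; apply: nF; exists n.
Qed.
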